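(* Let $n\ge 1$ and let $f(x)=x^TQx\in\mathcal{H}_{n,2}$ be a homogeneous quadratic polynomial with integer coefficients. Let $x^*$ be a global minimizer of $f$ over $\Delta_n$ with denominator $m$, i.e. $m\ge 1$ is an integer with $x^*\in\Delta(n,m)$ and $f(x^* )=\underline{f}$. Then for any integer $r\ge 1$, $$f_{\Delta(n,r)}-\underline{f}\le \frac{m}{r^2}\left(\overline{f}-\underline{f}\right).$$
   Context: $\mathcal{H}_{n,d}$ is the set of homogeneous polynomials of degree $d$ in $n$ variables with real coefficients. $\Delta_n=\{x\in\mathbb{R}^n: x_i\ge 0 \text{ for all } i,\ \sum_{i=1}^n x_i=1\}$ is the standard simplex. For an integer $r\ge1$, $\Delta(n,r)=\{x\in\Delta_n: rx\in\mathbb{N}^n\}$ (with $0\in\mathbb{N}$). Set $\underline{f}=\min_{x\in\Delta_n}f(x)$, $\overline{f}=\max_{x\in\Delta_n}f(x)$, and $f_{\Delta(n,r)}=\min_{x\in\Delta(n,r)}f(x)$. *)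

(* Defs.v *)
From mathcomp Require Import all_boot all_order all_algebra.
From mathcomp Require Import archimedean mpoly.
From mathcomp Require Import boolp classical_sets cardinality reals.
From mathcomp Require Import topology normedtype derive.

Set Implicit Arguments.
Unset Strict Implicit.
Unset Printing Implicit Defensive.

Import Order.TTheory GRing.Theory Num.Theory.
Import numFieldNormedType.Exports.

Local Open Scope classical_set_scope.
Local Open Scope ring_scope.

Section Definitions.
Variable R : realType.
Implicit Types (A : set R) (n r : nat).

(* [lbound A] and [ubound A] are the sets of lower and upper bounds of [A], so
   the element picked is the least (greatest) element of [A]. The default value
   0 is only reached when there is none, which never happens for the sets of
   values used here: see [minimum_simplexP], [maximum_simplexP] and
   [minimum_gridP]. *)
Definition minimum A : R := xget 0 (A `&` lbound A).
Definition maximum A : R := xget 0 (A `&` ubound A).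

Definition simplex n : set 'cV[R]_n :=
  [set x | (forall i, 0 <= x i 0) /\ \sum_i x i 0 = 1].

Definition grid n r : set 'cV[R]_n :=
  [set x | simplex x /\ forall i, r%:R * x i 0 \is a Num.nat].

Definition peval n (f : {mpoly R[n]}) (x : 'cV[R]_n) : R :=
  f.@[fun i => x i 0].

End Definitions.

Arguments simplex {R} n.
Arguments grid {R} n r.

Section Attainment.
Variable R : realType.
Implicit Types (A : set R) (n r : nat).

Lemma minimumP A v : A v -> lbound A v -> A (minimum A) /\ lbound A (minimum A).
Proof. by move=> Av lAv; apply: (@xgetPex _ 0 (A `&` lbound A)); exists v. Qed.

Lemma maximumP A v : A v -> ubound A v -> A (maximum A) /\ ubound A (maximum A).
Proof. by move=> Av uAv; apply: (@xgetPex _ 0 (A `&` ubound A)); exists v. Qed.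

Lemma continuous_sumr (T : topologicalType) (I : Type) (s : seq I)
    (F : I -> T -> R) :
  (forall i, continuous (F i)) -> continuous (fun x => \sum_(i <- s) F i x).
Proof.
move=> cF x; elim: s => [|i s IHs].
  by under eq_fun do rewrite big_nil; exact: cvg_cst.
under eq_fun do rewrite big_cons.
by apply: cvgD => //; exact: cF.
Qed.

Lemma continuous_prodr (T : topologicalType) (I : Type) (s : seq I)
    (F : I -> T -> R) :
  (forall i, continuous (F i)) -> continuous (fun x => \prod_(i <- s) F i x).
Proof.
move=> cF x; elim: s => [|i s IHs].
  by under eq_fun do rewrite big_nil; exact: cvg_cst.
under eq_fun do rewrite big_cons.
by apply: cvgM => //; exact: cF.
Qed.

Lemma continuous_scaler (T : topologicalType) (c : R) (F : T -> R) :
  continuous F -> continuous (fun x => c * F x).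
Proof. by move=> cF x; apply: cvgM; [exact: cvg_cst|exact: cF]. Qed.

Lemma continuous_expr (T : topologicalType) (F : T -> R) k :
  continuous F -> continuous (fun x => F x ^+ k).
Proof.
move=> cF x; elim: k => [|k IHk].
  by under eq_fun do rewrite expr0; exact: cvg_cst.
under eq_fun do rewrite exprS.
by apply: cvgM => //; exact: cF.
Qed.

Lemma peval_continuous n (f : {mpoly R[n]}) : continuous (peval f).
Proof.
have -> : peval f = fun x : 'cV[R]_n =>
    \sum_(k <- msupp f) f@_k * \prod_i x i 0 ^+ k i.
  by apply/funext => x; rewrite /peval mevalE.
apply: continuous_sumr => k; apply: continuous_scaler.
apply: continuous_prodr => i; apply: continuous_expr.
exact: coord_continuous.
Qed.

Lemma simplex_le1 n (x : 'cV[R]_n) i : simplex n x -> x i 0 <= 1.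
Proof.
by move=> [x0 <-]; rewrite (bigD1 i)//= lerDl; apply: sumr_ge0.
Qed.

Lemma simplex_compact n : compact (simplex n : set 'cV[R]_n).
Proof.
have cK : compact [set v : 'rV[R]_n | forall i, v ord0 i \in `[0, 1]%R].
  by apply: (@rV_compact R n (fun=> `[0, 1]%classic)) => _; exact: segment_compact.
have tc : continuous (@trmx R 1 n).
  move=> v A [/= P nP PA]; exists (fun i j => P j i).
    by move=> i j; have := nP j i; rewrite mxE.
  by move=> w wP; apply: PA => i j; rewrite mxE; exact: wP.
have cK' : compact [set x : 'cV[R]_n | forall i, x i 0 \in `[0, 1]%R].
  have -> : [set x : 'cV[R]_n | forall i, x i 0 \in `[0, 1]%R] =
      @trmx R 1 n @` [set v : 'rV[R]_n | forall i, v ord0 i \in `[0, 1]%R].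
    apply/seteqP; split => [x xK|_ [v vK <-] i]; last by rewrite mxE.
    by exists x^T; [move=> i; rewrite mxE|rewrite trmxK].
  by apply: continuous_compact => //; exact: continuous_subspaceT.
apply: (subclosed_compact _ cK').
  have -> : (simplex n : set 'cV[R]_n) =
      \bigcap_i [set x : 'cV[R]_n | 0 <= x i 0] `&` [set x | \sum_i x i 0 = 1].
    apply/seteqP; split => x [x0 x1]; split => //= i; first by move=> _; exact: x0.
    exact: x0.
  apply: closedI.
    apply: closed_bigI => i _.
    apply: (@preimage_closed _ _ (fun x : 'cV[R]_n => x i 0) [set t | 0 <= t]).
      by move=> x _; exact: coord_continuous.
    exact: closed_ge.
  apply: (@preimage_closed _ _ (fun x : 'cV[R]_n => \sum_i x i 0) [set 1]).
    by move=> x _; apply: continuous_sumr => i; exact: coord_continuous.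
  exact: closed_eq.
by move=> x xS i; rewrite in_itv/= (proj1 xS)/= (simplex_le1 _ xS).
Qed.

Lemma grid_nonempty n r : (0 < n)%N -> (grid n r : set 'cV[R]_n) !=set0.
Proof.
case: n => // n _; exists (delta_mx 0 0); split; [split|].
- by move=> i; rewrite mxE ler0n.
- rewrite (bigD1 0)//= big1 => [|i /negbTE i0]; last by rewrite mxE i0.
  by rewrite mxE/= addr0.
- by move=> i; rewrite mxE -natrM natr_nat.
Qed.

Lemma grid_finite n r : (0 < r)%N -> finite_set (grid n r : set 'cV[R]_n).
Proof.
move=> r0; have rN0 : r%:R != 0 :> R by rewrite pnatr_eq0 -lt0n.
pose h (k : {ffun 'I_n -> 'I_r.+1}) : 'cV[R]_n := \col_i ((k i)%:R / r%:R).
apply: (@sub_finite_set _ _ (range h)); last first.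
  by apply: finite_image; exact: finite_finset.
move=> x [xS xN].
exists [ffun i => inord (Num.truncn (r%:R * x i 0))] => //.
apply/matrixP => i j; rewrite (ord1 j) mxE ffunE.
have /natrP[k kE] := xN i.
rewrite kE natrK inordK; first by rewrite -kE mulrC mulKf.
rewrite ltnS -(ler_nat R) -kE -[leRHS]mulr1.
by rewrite ler_wpM2l ?ler0n// (simplex_le1 _ xS).
Qed.

Lemma minimum_simplexP n (f : {mpoly R[n]}) : (0 < n)%N ->
  let v := minimum (peval f @` simplex n) in
  (peval f @` simplex n) v /\ lbound (peval f @` simplex n) v.
Proof.
move=> n0; have [x [xS _]] := grid_nonempty 1 n0.
have [||c /set_mem cS cm] :=
  @compact_EVT_min _ _ (peval f) _ _ (@simplex_compact n); first by exists x.
  exact/continuous_subspaceT/peval_continuous.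
apply: (@minimumP _ (peval f c)); first by exists c.
by move=> _ [y yS <-]; exact/cm/mem_set.
Qed.

Lemma maximum_simplexP n (f : {mpoly R[n]}) : (0 < n)%N ->
  let v := maximum (peval f @` simplex n) in
  (peval f @` simplex n) v /\ ubound (peval f @` simplex n) v.
Proof.
move=> n0; have [x [xS _]] := grid_nonempty 1 n0.
have [||c /set_mem cS cm] :=
  @compact_EVT_max _ _ (peval f) _ _ (@simplex_compact n); first by exists x.
  exact/continuous_subspaceT/peval_continuous.
apply: (@maximumP _ (peval f c)); first by exists c.
by move=> _ [y yS <-]; exact/cm/mem_set.
Qed.

Lemma minimum_gridP n r (f : {mpoly R[n]}) : (0 < n)%N -> (0 < r)%N ->
  let v := minimum (peval f @` grid n r) in
  (peval f @` grid n r) v /\ lbound (peval f @` grid n r) v.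
Proof.
move=> n0 r0.
have [||c /set_mem cS cm] := @compact_EVT_min _ _ (peval f) (grid n r)
    (grid_nonempty r n0).
- exact/finite_compact/grid_finite.
- exact/continuous_subspaceT/peval_continuous.
apply: (@minimumP _ (peval f c)); first by exists c.
by move=> _ [y yS <-]; exact/cm/mem_set.
Qed.

End Attainment.

(* Main.v *)
Require Import Defs.
From mathcomp Require Import all_boot all_order all_algebra.
From mathcomp Require Import archimedean mpoly.
From mathcomp Require Import boolp classical_sets reals.
From mathcomp Require Import ring.

Import Order.TTheory GRing.Theory Num.Theory.

Local Open Scope classical_set_scope.
Local Open Scope ring_scope.

(** Write [r = k * m + s] with [s < m]. The vector [(k * m) *: xstar] already has
   natural coordinates, so a grid point near [xstar] is obtained by adding [s]
   random unit vectors [e_i], drawn independently with law [xstar], and dividing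
   by [r]. The resulting random point has mean [xstar], and
   independent draws are uncorrelated, so the quadratic form [f] exceeds its
   value at the mean only through the variance of each single draw: the expected
   value of [f] is [f xstar + s / r ^ 2 * V] with
   [V = \sum_i xstar_i * f e_i - f xstar]. As [f e_i] is at most the maximum and
   [f xstar] is the minimum, [V] is at most the range of [f] on the simplex;
   and [s <= m].

   No probability is needed: the draws are made one at a time, each time picking
   a vertex that does at least as well as the average over the vertices
   ([exists_vertex_le]), and the excess [V] is paid once per draw
   ([exists_natural_increment]). *)

Section QuadraticForm.
Variables (R : realType) (n : nat) (Q : 'M[R]_n).
Implicit Types (a b x y : 'cV[R]_n) (s : nat).

Definition qform x : R := (x^T *m Q *m x) 0 0.

Lemma qformZ c x : qform (c *: x) = c ^+ 2 * qform x.
Proof.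
by rewrite /qform [(c *: x)^T]linearZ /= -scalemxAr -!scalemxAl !mxE mulrA expr2.
Qed.

Lemma qformD b y :
  qform (b + y) = qform b + qform y + \sum_i (b^T *m (Q + Q^T)) 0 i * y i 0.
Proof.
have addE (A B : 'M[R]_1) : (A + B) 0 0 = A 0 0 + B 0 0.
  by rewrite mxE.
have -> : \sum_i (b^T *m (Q + Q^T)) 0 i * y i 0 =
    (b^T *m Q *m y) 0 0 + (y^T *m Q *m b) 0 0.
  have -> : y^T *m Q *m b = (b^T *m Q^T *m y)^T.
    by rewrite !trmx_mul !trmxK mulmxA.
  by rewrite [(_^T) 0 0]mxE -addE -mulmxDl -mulmxDr [RHS]mxE.
by rewrite /qform [(b + y)^T]linearD /= !mulmxDl !mulmxDr !addE; ring.
Qed.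

(** The expected value of [qform] at a random vertex of law [x], minus its value at
   the mean [x]. *)
Definition vertex_excess x : R :=
  \sum_i x i 0 * qform (delta_mx i 0) - qform x.

(** The difference [qform (b + y) - qform y] is affine in [y], so averaging it over
   the vertices gives its value at [x]. *)
Lemma qform_vertex_average b x : \sum_i x i 0 = 1 ->
  \sum_i x i 0 * qform (b + delta_mx i 0) = qform (b + x) + vertex_excess x.
Proof.
move=> x1; rewrite qformD /vertex_excess.
have E i : x i 0 * qform (b + delta_mx i 0) =
    x i 0 * qform b + x i 0 * qform (delta_mx i 0) +
    (b^T *m (Q + Q^T)) 0 i * x i 0.
  rewrite qformD [X in _ + X](bigD1 i) //= big1 => [|j /negbTE ji].
    by rewrite [delta_mx i 0 i 0]mxE !eqxx mulr1 addr0; ring.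
  by rewrite [delta_mx i 0 j 0]mxE ji mulr0.
under eq_bigr do rewrite E.
by rewrite !big_split /= -mulr_suml x1; ring.
Qed.

Lemma exists_vertex_le b x : simplex n x ->
  exists i, qform (b + delta_mx i 0) <= qform (b + x) + vertex_excess x.
Proof.
move=> [x0 x1]; rewrite -qform_vertex_average //.
have [i0 _|n0] := pickP 'I_n; last first.
  by have := oner_neq0 R; rewrite -x1 big_pred0 ?eqxx.
pose g i := qform (b + delta_mx i 0).
have [i _ gi] := Order.TotalTheory.arg_minP g (erefl : xpredT i0).
exists i; rewrite -[leLHS]mul1r -x1 mulr_suml.
by apply: ler_sum => j _; rewrite ler_wpM2l // gi.
Qed.

(** The base point [a] is arbitrary so that the induction can absorb the vertex
   picked first into it. *)
Lemma exists_natural_increment x s a : simplex n x ->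
  exists y, [/\ forall i, y i 0 \is a Num.nat, \sum_i y i 0 = s%:R &
    qform (a + y) <= qform (a + s%:R *: x) + s%:R * vertex_excess x].
Proof.
move=> xS; elim: s a => [|s IHs] a.
  exists 0; split.
  - by move=> i; rewrite mxE rpred0.
  - by rewrite big1 // => i _; rewrite mxE.
  - by rewrite scale0r mul0r !addr0.
have [i le_i] := exists_vertex_le (a + s%:R *: x) x xS.
have [y [yN ys le_y]] := IHs (a + delta_mx i 0).
exists (delta_mx i 0 + y); split.
- by move=> j; rewrite !mxE rpredD // natr_nat.
- under eq_bigr do rewrite mxE.
  rewrite big_split /= ys (bigD1 i) //= big1 => [|j /negbTE ji].
    by rewrite mxE !eqxx addr0 -natr1 addrC.
  by rewrite mxE ji.
- rewrite addrA (le_trans le_y) // addrAC -natr1 scalerDl scale1r addrA mulrDl.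
  by rewrite mul1r [_ * _ + _]addrC addrA lerD2r.
Qed.

End QuadraticForm.

Lemma simplex_vertex (R : realType) n (i : 'I_n) :
  simplex n (delta_mx i 0 : 'cV[R]_n).
Proof.
split=> [j|]; first by rewrite mxE ler0n.
rewrite (bigD1 i) //= big1 => [|j /negbTE ji]; last by rewrite mxE ji.
by rewrite mxE !eqxx addr0.
Qed.

Theorem theorem2p2 (R : realType) (n : nat) (n_ge1 : (1 <= n)%N)
    (Q : 'M[R]_n) (f : {mpoly R[n]})
    (f_homog : f \is 2.-homog)
    (fE : forall x : 'cV[R]_n, peval f x = (x^T *m Q *m x) 0 0)
    (f_int : forall k : 'X_{1..n}, f@_k \is a Num.int)
    (m : nat) (m_ge1 : (1 <= m)%N)
    (xstar : 'cV[R]_n) (xstar_grid : grid n m xstar)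
    (xstar_min : peval f xstar = minimum (peval f @` simplex n))
    (r : nat) (r_ge1 : (1 <= r)%N) :
  minimum (peval f @` grid n r) - minimum (peval f @` simplex n) <=
  m%:R / r%:R ^+ 2 *
    (maximum (peval f @` simplex n) - minimum (peval f @` simplex n)).
Proof.
have [xS xm] := xstar_grid.
have [x0 x1] := xS.
have [_ gmin] := minimum_gridP f n_ge1 r_ge1.
have [_ smax] := maximum_simplexP f n_ge1.
have r0 : (0 : R) < r%:R by rewrite ltr0n.
have rN0 : (r%:R : R) != 0 by rewrite gt_eqF.
rewrite -xstar_min in gmin *.
set M := maximum _ in smax *; set G := minimum _ in gmin *.
have fq y : peval f y = qform R n Q y := fE y.
have V_le : vertex_excess R n Q xstar <= M - peval f xstar.
  rewrite fq lerD2r -[leRHS]mul1r -x1 mulr_suml.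
  apply: ler_sum => i _; rewrite ler_wpM2l // -fq.
  by apply: smax; exists (delta_mx i 0) => //; exact: simplex_vertex.
have range_ge0 : 0 <= M - peval f xstar.
  by rewrite subr_ge0; apply: smax; exists xstar.
pose k := (r %/ m)%N; pose s := (r %% m)%N.
have rE : (k * m)%:R + s%:R = r%:R :> R by rewrite -natrD -divn_eq.
have s_le_m : (s%:R : R) <= m%:R by rewrite ler_nat ltnW // ltn_mod.
have [y [yN ys y_le]] :=
  exists_natural_increment R n Q xstar s ((k * m)%:R *: xstar) xS.
set z := (k * m)%:R *: xstar + y in y_le.
have zN i : z i 0 \is a Num.nat.
  by rewrite !mxE natrM -mulrA rpredD // rpredM // natr_nat.
have z_sum : \sum_i z i 0 = r%:R.
  under eq_bigr do rewrite !mxE.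
  by rewrite big_split /= ys -mulr_sumr x1 mulr1.
have z_grid : grid n r (r%:R^-1 *: z).
  split; [split=> [i|]|move=> i].
  - by rewrite mxE mulr_ge0 ?invr_ge0 ?natr_ge0 // ltW.
  - by under eq_bigr do rewrite mxE; rewrite -mulr_sumr z_sum mulVf.
  - by rewrite mxE mulVKf.
have G_le : G <= r%:R ^- 2 * qform R n Q z.
  by rewrite -exprVn -qformZ -fq; apply: gmin; exists (r%:R^-1 *: z).
rewrite -scalerDl rE qformZ -(fq xstar) in y_le.
rewrite lerBlDr (le_trans G_le) // mulrC ler_pdivrMr ?exprn_gt0 //.
rewrite (le_trans y_le) // mulrDl addrC [_ * r%:R ^+ 2]mulrAC divfK ?expf_neq0 //.
rewrite [peval f xstar * _]mulrC lerD2r.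
by rewrite (le_trans (ler_wpM2l (ler0n R s) V_le)) // ler_wpM2r.
Qed.
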